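(* Let $(A,\Delta)$ be a left multiplier Hopf algebra and let $\varepsilon:A\to\mathbb C$ be its counit. Then for all $a\in A$, $$\sum_{(a)} a_{(1)}\varepsilon(a_{(2)})=a\qquad\text{and}\qquad \sum_{(a)}\varepsilon(a_{(1)})a_{(2)}=a$$ as left multipliers; that is, $(\iota\otimes\varepsilon)(\Delta(a)(c\otimes 1))=ac$ and $(\varepsilon\otimes\iota)(\Delta(a)(1\otimes b))=ab$ for all $a,b,c\in A$.
   Context: Algebras are associative algebras over $\mathbb C$, not necessarily unital, and $A$ is non-degenerate: if $ab=0$ for all $b\in A$ then $a=0$, and if $ab=0$ for all $a\in A$ then $b=0$. $M(A\otimes A)$ denotes the multiplier algebra of $A\otimes A$ and $\iota$ the identity map. A left multiplier Hopf algebra is a pair $(A,\Delta)$ where $A$ is a non-degenerate algebra and $\Delta:A\to M(A\otimes A)$ is a homomorphism such that: the maps $T_1(a\otimes b)=\Delta(a)(1\otimes b)$ and $T_4(c\otimes a)=\Delta(a)(c\otimes 1)$ have range in $A\otimes A$; $\Delta$ is coassociative, i.e. $((\Delta\otimes\iota)(\Delta(a)(1\otimes b)))(c\otimes 1\otimes 1)=((\iota\otimes\Delta)(\Delta(a)(c\otimes 1)))(1\otimes 1\otimes b)$ for all $a,b,c\in A$; and $T_1$, $T_4$ are bijections from $A\otimes A$ to itself. The counit $\varepsilon:A\to\mathbb C$ is the linear map determined by $\varepsilon(a)b=m(T_1^{-1}(a\otimes b))$ for all $a,b\in A$, where $m:A\otimes A\to A$ is multiplication (the left multiplier $b\mapsto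 m(T_1^{-1}(a\otimes b))$ is a scalar multiple of the identity for every $a$). It coincides with the linear map $\varepsilon'$ determined by $\varepsilon'(a)c=m^{\mathrm{op}}(T_4^{-1}(c\otimes a))$, where $m^{\mathrm{op}}(p\otimes q)=qp$. Sweedler notation: $\Delta(a)(1\otimes b)=\sum_{(a)}a_{(1)}\otimes a_{(2)}b$ and $\Delta(a)(c\otimes 1)=\sum_{(a)}a_{(1)}c\otimes a_{(2)}$. *)

(* Defs.v *)
From HB Require Import structures.
From mathcomp Require Import all_boot all_order all_algebra.
From mathcomp Require Import sesquilinear.
From mathcomp Require Import boolp classical_sets functions.

Set Implicit Arguments.
Unset Strict Implicit.
Unset Printing Implicit Defensive.

Import GRing.Theory.
Local Open Scope ring_scope.
Local Open Scope quotient_scope.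

#[local] Obligation Tactic := idtac.

Reserved Notation "x ** y" (at level 40, left associativity).
Reserved Notation "U ⊗ V" (at level 40, left associativity).
Reserved Notation "u \ox v" (at level 40, left associativity).

Lemma linear_ext (K : pzRingType) (U V : lmodType K) (f g : {linear U -> V}) :
  f =1 g -> f = g.
Proof.
case: f g => [f [[fA] [fZ]]] [g [[gA] [gZ]]] /= /funext fg.
have {}fg : f = g by [].
move: fA fZ gA gZ; rewrite fg => fA fZ gA gZ.
by rewrite (Prop_irrelevance fA gA) (Prop_irrelevance fZ gZ).
Qed.

Lemma bilinearI (K : fieldType) (U V W : lmodType K) (f : U -> V -> W) :
  (forall v k u u', f (k *: u + u') v = k *: f u v + f u' v) ->
  (forall u k v v', f u (k *: v + v') = k *: f u v + f u v') ->
  bilinear_for *:%R *:%R f.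
Proof. by []. Qed.

HB.mixin Record Lmodule_isNuAlgebra (K : fieldType) A of GRing.Lmodule K A := {
  numul : A -> A -> A;
  numulA : associative numul;
  numul_bilinear : bilinear_for *:%R *:%R numul
}.

(* Associative algebras over K without any unit requirement (mathcomp's algType
   is unital). *)
#[short(type="nuAlgType")]
HB.structure Definition NuAlgebra (K : fieldType) :=
  {A of GRing.Lmodule K A & Lmodule_isNuAlgebra K A}.

Notation "x ** y" := (numul x y) : ring_scope.

HB.instance Definition _ (K : fieldType) (A : nuAlgType K) :=
  bilinear_isBilinear.Build K A A A *:%R *:%R (@numul K A)
    (@numul_bilinear K A).
HB.instance Definition _ (K : fieldType) (A : nuAlgType K) (a : A) :=
  GRing.isLinear.Build K A A *:%R (numul a) ((@numul_bilinear K A).2 a).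

Section NuAlgebraTheory.
Variables (K : fieldType) (A : nuAlgType K).
Lemma numulPl k (a b c : A) : (k *: a + b) ** c = k *: (a ** c) + b ** c.
Proof. exact: (@numul_bilinear K A).1. Qed.
Lemma numulPr k (a b c : A) : a ** (k *: b + c) = k *: (a ** b) + a ** c.
Proof. exact: (@numul_bilinear K A).2. Qed.
Lemma numulDl (x y z : A) : (x + y) ** z = x ** z + y ** z.
Proof. by have := numulPl 1 x y z; rewrite !scale1r. Qed.
Lemma numulDr (x y z : A) : z ** (x + y) = z ** x + z ** y.
Proof. by have := numulPr 1 z x y; rewrite !scale1r. Qed.
Lemma numul0l (x : A) : 0 ** x = 0.
Proof. by apply: (addrI (0 ** x)); rewrite -numulDl !addr0. Qed.
Lemma numul0r (x : A) : x ** 0 = 0.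
Proof. by apply: (addrI (x ** 0)); rewrite -numulDr !addr0. Qed.
Lemma numulZl k (x y : A) : (k *: x) ** y = k *: (x ** y).
Proof. by have := numulPl k x 0 y; rewrite numul0l !addr0. Qed.
Lemma numulZr k (x y : A) : x ** (k *: y) = k *: (x ** y).
Proof. by have := numulPr k x y 0; rewrite numul0r !addr0. Qed.
End NuAlgebraTheory.

Definition nondegenerate_alg (K : fieldType) (A : nuAlgType K) : Prop :=
  (forall a : A, (forall b, a ** b = 0) -> a = 0) /\
  (forall b : A, (forall a, a ** b = 0) -> b = 0).

Section Tensor.
Variables (K : fieldType) (U V : lmodType K).

(* A list [:: (u1, v1); ...; (un, vn)] stands for the formal sum of the
   u_i \ox v_i; scalars are absorbed in the entries.  tensor_eq is the congruence
   for concatenation generated by commutativity and bilinearity. *)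
Inductive tensor_eq : seq (U * V) -> seq (U * V) -> Prop :=
| tensor_eq_refl s : tensor_eq s s
| tensor_eq_sym s t : tensor_eq s t -> tensor_eq t s
| tensor_eq_trans s t r : tensor_eq s t -> tensor_eq t r -> tensor_eq s r
| tensor_eq_cat s s' t t' :
    tensor_eq s s' -> tensor_eq t t' -> tensor_eq (s ++ t) (s' ++ t')
| tensor_eq_catC s t : tensor_eq (s ++ t) (t ++ s)
| tensor_eq_0 v : tensor_eq [:: (0, v)] [::]
| tensor_eq_Dl u u' v : tensor_eq [:: (u + u', v)] [:: (u, v); (u', v)]
| tensor_eq_Dr u v v' : tensor_eq [:: (u, v + v')] [:: (u, v); (u, v')]
| tensor_eq_Z k u v : tensor_eq [:: (k *: u, v)] [:: (u, k *: v)].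

Definition tensor_eqb s t : bool := `[< tensor_eq s t >].

Lemma tensor_eqb_refl : reflexive tensor_eqb.
Proof. by move=> s; apply/asboolP/tensor_eq_refl. Qed.
Lemma tensor_eqb_sym : symmetric tensor_eqb.
Proof. by move=> s t; apply/asboolP/asboolP => /tensor_eq_sym. Qed.
Lemma tensor_eqb_trans : transitive tensor_eqb.
Proof.
by move=> s t r /asboolP ts /asboolP sr; apply/asboolP/(tensor_eq_trans ts sr).
Qed.

Canonical tensor_equiv :=
  EquivRel tensor_eqb tensor_eqb_refl tensor_eqb_sym tensor_eqb_trans.

Definition tensor := {eq_quot tensor_equiv}.
HB.instance Definition _ := Choice.on tensor.
HB.instance Definition _ := EqQuotient.on tensor.

Lemma tensor_pi_eq (s t : seq (U * V)) :
  tensor_eq s t -> \pi_tensor s = \pi_tensor t.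
Proof. by move=> st; apply/eqmodP/asboolP. Qed.

Lemma tensor_repr_pi (s : seq (U * V)) : tensor_eq (repr (\pi_tensor s)) s.
Proof. by apply/asboolP; have /eqmodP := reprK (\pi_tensor s). Qed.

Lemma tensorW (P : tensor -> Prop) :
  (forall s, P (\pi_tensor s)) -> forall x, P x.
Proof. by move=> Ps x; rewrite -[x]reprK; apply: Ps. Qed.

Definition tensor_add (x y : tensor) : tensor := \pi_tensor (repr x ++ repr y).
Definition tensor_scale (k : K) (x : tensor) : tensor :=
  \pi_tensor [seq (k *: p.1, p.2) | p <- repr x].
Definition tensor_opp (x : tensor) : tensor := tensor_scale (-1) x.
Definition tensor_zero : tensor := \pi_tensor [::].

Lemma tensor_add_pi s t :
  tensor_add (\pi_tensor s) (\pi_tensor t) = \pi_tensor (s ++ t).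
Proof. by apply/tensor_pi_eq/tensor_eq_cat; apply: tensor_repr_pi. Qed.

Lemma tensor_eq_scale k s t : tensor_eq s t ->
  tensor_eq [seq (k *: p.1, p.2) | p <- s] [seq (k *: p.1, p.2) | p <- t].
Proof.
elim=> {s t} /=.
- by move=> s; apply: tensor_eq_refl.
- by move=> s t _; apply: tensor_eq_sym.
- by move=> s t r _ + _; apply: tensor_eq_trans.
- by move=> s s' t t' _ ss _ tt; rewrite !map_cat; apply: tensor_eq_cat.
- by move=> s t; rewrite !map_cat; apply: tensor_eq_catC.
- by move=> v; rewrite scaler0; apply: tensor_eq_0.
- by move=> u u' v; rewrite scalerDr; apply: tensor_eq_Dl.
- by move=> u v v'; apply: tensor_eq_Dr.
- move=> l u v; rewrite scalerA mulrC -scalerA; exact: tensor_eq_Z.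
Qed.

Lemma tensor_scale_pi k s :
  tensor_scale k (\pi_tensor s) = \pi_tensor [seq (k *: p.1, p.2) | p <- s].
Proof. by apply/tensor_pi_eq/tensor_eq_scale/tensor_repr_pi. Qed.

Lemma tensor_addA : associative tensor_add.
Proof.
elim/tensorW=> s; elim/tensorW=> t; elim/tensorW=> r.
by rewrite !tensor_add_pi catA.
Qed.

Lemma tensor_addC : commutative tensor_add.
Proof.
elim/tensorW=> s; elim/tensorW=> t; rewrite !tensor_add_pi.
exact/tensor_pi_eq/tensor_eq_catC.
Qed.

Lemma tensor_add0 : left_id tensor_zero tensor_add.
Proof. by elim/tensorW=> s; rewrite tensor_add_pi. Qed.

Lemma tensor_scaleDl x :
  {morph tensor_scale^~ x : k l / k + l >-> tensor_add k l}.
Proof.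
move=> k l; elim/tensorW: x => s; rewrite !tensor_scale_pi tensor_add_pi.
apply: tensor_pi_eq; elim: s => [|[u v] s IHs] /=; first exact: tensor_eq_refl.
rewrite scalerDl.
apply: tensor_eq_trans (_ : tensor_eq ([:: (k *: u, v); (l *: u, v)] ++ _) _).
  exact: (tensor_eq_cat (tensor_eq_Dl _ _ _) IHs).
rewrite -[X in tensor_eq X]/([:: (k *: u, v)] ++ ([:: (l *: u, v)] ++ _)).
apply: (@tensor_eq_cat [:: _] [:: _]); first exact: tensor_eq_refl.
rewrite -[in X in tensor_eq _ X]cat1s !catA.
by apply: tensor_eq_cat; [apply: tensor_eq_catC | apply: tensor_eq_refl].
Qed.

Lemma tensor_scale0 x : tensor_scale 0 x = tensor_zero.
Proof.
elim/tensorW: x => s; rewrite tensor_scale_pi; apply: tensor_pi_eq.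
elim: s => [|[u v] s IHs] /=; first exact: tensor_eq_refl.
by rewrite scale0r; apply: (tensor_eq_cat (tensor_eq_0 v) IHs).
Qed.

Lemma tensor_scale1 : left_id 1 tensor_scale.
Proof.
elim/tensorW=> s; rewrite tensor_scale_pi; congr (\pi_tensor _).
by rewrite -[RHS]map_id; apply: eq_map => -[u v] /=; rewrite scale1r.
Qed.

Lemma tensor_addN : left_inverse tensor_zero tensor_opp tensor_add.
Proof.
move=> x; rewrite -[X in tensor_add _ X]tensor_scale1 -tensor_scaleDl.
by rewrite addNr tensor_scale0.
Qed.

HB.instance Definition _ := GRing.isZmodule.Build tensor
  tensor_addA tensor_addC tensor_add0 tensor_addN.

Lemma tensor_scaleA k l x :
  tensor_scale k (tensor_scale l x) = tensor_scale (k * l) x.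
Proof.
elim/tensorW: x => s; rewrite !tensor_scale_pi -map_comp; congr (\pi_tensor _).
by apply: eq_map => -[u v] /=; rewrite scalerA.
Qed.

Lemma tensor_scaleDr : right_distributive tensor_scale +%R.
Proof.
move=> k; elim/tensorW=> s; elim/tensorW=> t.
by rewrite /GRing.add /= !(tensor_add_pi, tensor_scale_pi) map_cat.
Qed.

HB.instance Definition _ := GRing.Zmodule_isLmodule.Build K tensor
  tensor_scaleA tensor_scale1 tensor_scaleDr tensor_scaleDl.

Lemma tensor_piD s t : \pi_tensor s + \pi_tensor t = \pi_tensor (s ++ t).
Proof. exact: tensor_add_pi. Qed.

Lemma tensor_piZ k s :
  k *: \pi_tensor s = \pi_tensor [seq (k *: p.1, p.2) | p <- s].
Proof. exact: tensor_scale_pi. Qed.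

Definition tens (u : U) (v : V) : tensor := \pi_tensor [:: (u, v)].

Lemma tens_is_bilinear : bilinear_for *:%R *:%R tens.
Proof.
split=> [v k u u' | u k v v'] /=; rewrite tensor_piZ tensor_piD;
  apply: tensor_pi_eq.
  exact: tensor_eq_Dl.
apply: tensor_eq_trans (tensor_eq_Dr _ _ _) _.
apply: (@tensor_eq_cat [:: _] [:: _]); last exact: tensor_eq_refl.
exact/tensor_eq_sym/tensor_eq_Z.
Qed.
HB.instance Definition _ :=
  bilinear_isBilinear.Build K U V tensor *:%R *:%R tens tens_is_bilinear.

Lemma tensor_elim (P : tensor -> Prop) :
  (forall u v, P (tens u v)) -> (forall x y, P x -> P y -> P (x + y)) ->
  forall x, P x.
Proof.
move=> Pt PD; elim/tensorW; elim=> [|[u v] s IHs].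
  have <- : tens 0 0 = \pi_tensor [::] by apply/tensor_pi_eq/tensor_eq_0.
  exact: Pt.
have -> : \pi_tensor ((u, v) :: s) = tens u v + \pi_tensor s.
  by rewrite tensor_piD.
exact: PD.
Qed.

Section Lift.
Variables (W : lmodType K) (f : {bilinear U -> V -> W}).

(* The universal property: the linear map u \ox v |-> f u v. *)
Definition tensor_lift (x : tensor) : W := \sum_(p <- repr x) f p.1 p.2.

Lemma tensor_lift_pi s : tensor_lift (\pi_tensor s) = \sum_(p <- s) f p.1 p.2.
Proof.
rewrite /tensor_lift; have: tensor_eq (repr (\pi_tensor s)) s.
  exact: tensor_repr_pi.
move: (repr _) => t; elim=> {s t} //=.
- by move=> s t r _ -> _ ->.
- by move=> s s' t t' _ ss _ tt; rewrite !big_cat /= ss tt.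
- by move=> s t; rewrite !big_cat /= addrC.
- by move=> v; rewrite big_seq1 big_nil /= linear0l.
- by move=> u u' v; rewrite !(big_cons, big_nil) !addr0 /= linearDl.
- by move=> u v v'; rewrite !(big_cons, big_nil) !addr0 /= linearDr.
- by move=> k u v; rewrite !big_seq1 /= linearZl_LR linearZr_LR.
Qed.

Lemma tensor_liftE u v : tensor_lift (tens u v) = f u v.
Proof. by rewrite tensor_lift_pi big_seq1. Qed.

Lemma tensor_lift_is_linear : linear tensor_lift.
Proof.
move=> k; elim/tensorW=> s; elim/tensorW=> t.
rewrite tensor_piZ tensor_piD !tensor_lift_pi big_cat big_map scaler_sumr; congr (_ + _).
by apply: eq_bigr => p _ /=; rewrite linearZl_LR.
Qed.
HB.instance Definition _ := GRing.isLinear.Build K tensor W *:%R tensor_lift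
  tensor_lift_is_linear.

Lemma tensor_liftD x y : tensor_lift (x + y) = tensor_lift x + tensor_lift y.
Proof. exact: linearD. Qed.

Lemma tensor_lift_uniq (g : {linear tensor -> W}) :
  (forall u v, g (tens u v) = f u v) -> g =1 tensor_lift.
Proof.
move=> gE; elim/tensor_elim => [u v | x y gx gy]; first by rewrite tensor_liftE.
by rewrite !linearD gx gy.
Qed.
End Lift.

End Tensor.


Notation "U ⊗ V" := (tensor U V).
Notation "u \ox v" := (tens u v) : ring_scope.

Section TensTheory.
Variables (K : fieldType) (U V : lmodType K).
Lemma tensPl k (u u' : U) (v : V) :
  (k *: u + u') \ox v = k *: (u \ox v) + u' \ox v.
Proof. exact: (tens_is_bilinear U V).1. Qed.
Lemma tensPr k (u : U) (v v' : V) :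
  u \ox (k *: v + v') = k *: (u \ox v) + u \ox v'.
Proof. exact: (tens_is_bilinear U V).2. Qed.
End TensTheory.

Lemma tensor_elim2 (K : fieldType) (U V U' V' : lmodType K)
    (P : U ⊗ V -> U' ⊗ V' -> Prop) :
  (forall u v u' v', P (u \ox v) (u' \ox v')) ->
  (forall x y z, P x z -> P y z -> P (x + y) z) ->
  (forall z x y, P z x -> P z y -> P z (x + y)) -> forall x y, P x y.
Proof.
move=> Pt PDl PDr; elim/tensor_elim => [u v | x y Px Py] z; last exact: PDl.
by elim/tensor_elim: z => [u' v' | x y]; [apply: Pt | apply: PDr].
Qed.

Section TensorMap.
Variables (K : fieldType) (U V U' V' : lmodType K).
Variables (f : {linear U -> U'}) (g : {linear V -> V'}).

Definition tensor_map_core (u : U) (v : V) : U' ⊗ V' := f u \ox g v.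
Lemma tensor_map_core_bilinear : bilinear_for *:%R *:%R tensor_map_core.
Proof.
apply: bilinearI => [v k u u' | u k v v']; rewrite /tensor_map_core linearP.
  by rewrite tensPl.
by rewrite tensPr.
Qed.
HB.instance Definition _ := bilinear_isBilinear.Build K U V (U' ⊗ V') *:%R *:%R
  tensor_map_core tensor_map_core_bilinear.

Definition tensor_map : {linear U ⊗ V -> U' ⊗ V'} :=
  tensor_lift tensor_map_core.

Lemma tensor_mapE u v : tensor_map (u \ox v) = f u \ox g v.
Proof. exact: tensor_liftE. Qed.

Lemma tensor_mapD x y : tensor_map (x + y) = tensor_map x + tensor_map y.
Proof. exact: tensor_liftD. Qed.
End TensorMap.

Section TensorAlgebra.
Variables (K : fieldType) (A B : nuAlgType K).

Definition tensor_mul_core (y : A ⊗ B) (a : A) (b : B) : A ⊗ B :=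
  tensor_map (numul a) (numul b) y.
Lemma tensor_mul_core_bilinear y : bilinear_for *:%R *:%R (tensor_mul_core y).
Proof.
rewrite /tensor_mul_core.
apply: bilinearI => [b k a a' | a k b b']; elim/tensor_elim: y => [c d | x y xE yE].
- by rewrite !tensor_mapE /= numulPl tensPl.
- by rewrite !linearD xE yE; apply: addrACA.
- by rewrite !tensor_mapE /= numulPl tensPr.
- by rewrite !linearD xE yE; apply: addrACA.
Qed.
HB.instance Definition _ y :=
  bilinear_isBilinear.Build K A B (A ⊗ B) *:%R *:%R
    (tensor_mul_core y) (tensor_mul_core_bilinear y).

(* The product determined by (a \ox b) (a' \ox b') = aa' \ox bb'. *)
Definition tensor_mul (x y : A ⊗ B) : A ⊗ B :=
  tensor_lift (tensor_mul_core y) x.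

Lemma tensor_mul_tens a b a' b' :
  tensor_mul (a \ox b) (a' \ox b') = (a ** a') \ox (b ** b').
Proof. by rewrite /tensor_mul tensor_liftE; apply: tensor_mapE. Qed.

Lemma tensor_mulDl x x' y :
  tensor_mul (x + x') y = tensor_mul x y + tensor_mul x' y.
Proof. exact: linearD. Qed.

Lemma tensor_mul_bilinear : bilinear_for *:%R *:%R tensor_mul.
Proof.
apply: bilinearI => [y k x x' | x k y y']; first by rewrite /tensor_mul linearP.
elim/tensor_elim: x => [a b | x x' xE x'E].
  by rewrite /tensor_mul !tensor_liftE; apply: linearP.
by rewrite !tensor_mulDl xE x'E scalerDr addrACA.
Qed.

Lemma tensor_mulA : associative tensor_mul.
Proof.
have mDr x y z : tensor_mul z (x + y) = tensor_mul z x + tensor_mul z y.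
  by have := tensor_mul_bilinear.2 z 1 x y; rewrite /= !scale1r.
move=> x y z.
elim/tensor_elim: x => [a b | x x' xE x'E]; last by rewrite !tensor_mulDl xE x'E.
elim/tensor_elim: y => [a' b' | y y' yE y'E].
  elim/tensor_elim: z => [a'' b'' | z z' zE z'E].
    by rewrite !tensor_mul_tens !numulA.
  by rewrite !mDr zE z'E.
by rewrite !(tensor_mulDl, mDr) yE y'E.
Qed.

HB.instance Definition _ :=
  Lmodule_isNuAlgebra.Build K (A ⊗ B) tensor_mulA tensor_mul_bilinear.

Lemma tens_mul (a a' : A) (b b' : B) :
  (a \ox b) ** (a' \ox b') = (a ** a') \ox (b ** b').
Proof. exact: tensor_mul_tens. Qed.

End TensorAlgebra.

Definition numul_r (K : fieldType) (A : nuAlgType K) (b a : A) : A := a ** b.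
HB.instance Definition _ (K : fieldType) (A : nuAlgType K) (b : A) :=
  GRing.isLinear.Build K A A *:%R (numul_r b) ((@numul_bilinear K A).1 b).

(* An element m of the multiplier algebra M(B) is the pair of linear maps
   x |-> m x (mult_l) and x |-> x m (mult_r) on B, subject to m (x y) = (m x) y,
   (x y) m = x (y m) and x (m y) = (x m) y. *)
Record multiplier (K : fieldType) (B : nuAlgType K) := Multiplier {
  mult_l : {linear B -> B};
  mult_r : {linear B -> B};
  mult_lM : forall x y, mult_l (x ** y) = mult_l x ** y;
  mult_rM : forall x y, mult_r (x ** y) = x ** mult_r y;
  mult_lr : forall x y, x ** mult_l y = mult_r x ** y
}.
HB.instance Definition _ (K : fieldType) (B : nuAlgType K) :=
  gen_eqMixin (multiplier B).
HB.instance Definition _ (K : fieldType) (B : nuAlgType K) :=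
  gen_choiceMixin (multiplier B).

Section MultiplierAlgebra.
Variables (K : fieldType) (B : nuAlgType K).
Implicit Types (m n : multiplier B) (x y : B) (k : K).

Lemma multiplier_ext m n :
  mult_l m =1 mult_l n -> mult_r m =1 mult_r n -> m = n.
Proof.
case: m n => [l r lM rM lr] [l' r' lM' rM' lr'] /= /linear_ext ll /linear_ext rr.
move: lM' rM' lr'; rewrite -ll -rr => lM' rM' lr'.
by congr Multiplier; apply: Prop_irrelevance.
Qed.

Program Definition multiplier_zero : multiplier B :=
  @Multiplier K B (\0 : {linear B -> B}) (\0 : {linear B -> B}) _ _ _.
Next Obligation. by move=> x y /=; rewrite numul0l. Qed.
Next Obligation. by move=> x y /=; rewrite numul0r. Qed.
Next Obligation. by move=> x y /=; rewrite numul0l numul0r. Qed.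

Program Definition multiplier_add m n : multiplier B :=
  @Multiplier K B (mult_l m \+ mult_l n : {linear B -> B})
    (mult_r m \+ mult_r n : {linear B -> B}) _ _ _.
Next Obligation. by move=> m n x y /=; rewrite !mult_lM numulDl. Qed.
Next Obligation. by move=> m n x y /=; rewrite !mult_rM numulDr. Qed.
Next Obligation. by move=> m n x y /=; rewrite numulDl numulDr !mult_lr. Qed.

Program Definition multiplier_scale k m : multiplier B :=
  @Multiplier K B (k \*: mult_l m : {linear B -> B})
    (k \*: mult_r m : {linear B -> B}) _ _ _.
Next Obligation. by move=> k m x y /=; rewrite mult_lM numulZl. Qed.
Next Obligation. by move=> k m x y /=; rewrite mult_rM numulZr. Qed.
Next Obligation. by move=> k m x y /=; rewrite numulZl numulZr mult_lr. Qed.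

Definition multiplier_opp m := multiplier_scale (-1) m.

Lemma multiplier_addA : associative multiplier_add.
Proof. by move=> m n p; apply: multiplier_ext => x /=; rewrite addrA. Qed.
Lemma multiplier_addC : commutative multiplier_add.
Proof. by move=> m n; apply: multiplier_ext => x /=; rewrite addrC. Qed.
Lemma multiplier_add0 : left_id multiplier_zero multiplier_add.
Proof. by move=> m; apply: multiplier_ext => x /=; rewrite add0r. Qed.
Lemma multiplier_addN :
  left_inverse multiplier_zero multiplier_opp multiplier_add.
Proof.
by move=> m; apply: multiplier_ext => x /=; rewrite scaleN1r addNr.
Qed.
HB.instance Definition _ := GRing.isZmodule.Build (multiplier B)
  multiplier_addA multiplier_addC multiplier_add0 multiplier_addN.

Lemma multiplier_scaleA k l m :
  multiplier_scale k (multiplier_scale l m) = multiplier_scale (k * l) m.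
Proof. by apply: multiplier_ext => x /=; rewrite scalerA. Qed.
Lemma multiplier_scale1 : left_id 1 multiplier_scale.
Proof. by move=> m; apply: multiplier_ext => x /=; rewrite scale1r. Qed.
Lemma multiplier_scaleDr : right_distributive multiplier_scale +%R.
Proof. by move=> k m n; apply: multiplier_ext => x /=; rewrite scalerDr. Qed.
Lemma multiplier_scaleDl m : {morph multiplier_scale^~ m : k l / k + l}.
Proof. by move=> k l; apply: multiplier_ext => x /=; rewrite scalerDl. Qed.
HB.instance Definition _ := GRing.Zmodule_isLmodule.Build K (multiplier B)
  multiplier_scaleA multiplier_scale1 multiplier_scaleDr multiplier_scaleDl.

Program Definition multiplier_mul m n : multiplier B :=
  @Multiplier K B (mult_l m \o mult_l n : {linear B -> B})
    (mult_r n \o mult_r m : {linear B -> B}) _ _ _.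
Next Obligation. by move=> m n x y /=; rewrite !mult_lM. Qed.
Next Obligation. by move=> m n x y /=; rewrite !mult_rM. Qed.
Next Obligation. by move=> m n x y /=; rewrite !mult_lr. Qed.

Lemma multiplier_mulA : associative multiplier_mul.
Proof. by move=> m n p; apply: multiplier_ext. Qed.
Lemma multiplier_mul_bilinear : bilinear_for *:%R *:%R multiplier_mul.
Proof.
by apply: bilinearI => [n k m m' | m k n n']; apply: multiplier_ext => x //=;
  rewrite linearP.
Qed.
HB.instance Definition _ := Lmodule_isNuAlgebra.Build K (multiplier B)
  multiplier_mulA multiplier_mul_bilinear.

Program Definition multiplier_one : multiplier B :=
  @Multiplier K B (idfun : {linear B -> B}) (idfun : {linear B -> B}) _ _ _.
Next Obligation. by []. Qed.
Next Obligation. by []. Qed.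
Next Obligation. by []. Qed.

(* The canonical homomorphism B -> M(B), injective when B is non-degenerate. *)
Program Definition to_multiplier (b : B) : multiplier B :=
  @Multiplier K B (numul b : {linear B -> B}) (numul_r b : {linear B -> B})
    _ _ _.
Next Obligation. by move=> b x y /=; rewrite numulA. Qed.
Next Obligation. by move=> b x y /=; rewrite /numul_r numulA. Qed.
Next Obligation. by move=> b x y /=; rewrite /numul_r numulA. Qed.

Lemma to_multiplier_is_linear : linear to_multiplier.
Proof.
move=> k x y; apply: multiplier_ext => z /=; first exact: numulPl.
exact: numulPr.
Qed.
HB.instance Definition _ := GRing.isLinear.Build K B (multiplier B) *:%R
  to_multiplier to_multiplier_is_linear.

End MultiplierAlgebra.

Section MultiplierTensor.
Variables (K : fieldType) (B C : nuAlgType K).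

Program Definition multiplier_tens (m : multiplier B) (n : multiplier C) :
    multiplier (B ⊗ C) :=
  @Multiplier K (B ⊗ C) (tensor_map (mult_l m) (mult_l n))
    (tensor_map (mult_r m) (mult_r n)) _ _ _.
Next Obligation.
move=> m n; apply: tensor_elim2 => [b c b' c' | x x' y xE x'E | x y y' yE y'E].
- by rewrite tens_mul !tensor_mapE tens_mul !mult_lM.
- by rewrite numulDl !tensor_mapD xE x'E numulDl.
- by rewrite numulDr tensor_mapD yE y'E numulDr.
Qed.
Next Obligation.
move=> m n; apply: tensor_elim2 => [b c b' c' | x x' y xE x'E | x y y' yE y'E].
- by rewrite tens_mul !tensor_mapE tens_mul !mult_rM.
- by rewrite numulDl tensor_mapD xE x'E numulDl.
- by rewrite numulDr !tensor_mapD yE y'E numulDr.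
Qed.
Next Obligation.
move=> m n; apply: tensor_elim2 => [b c b' c' | x x' y xE x'E | x y y' yE y'E].
- by rewrite !tensor_mapE !tens_mul !mult_lr.
- by rewrite tensor_mapD !numulDl xE x'E.
- by rewrite tensor_mapD !numulDr yE y'E.
Qed.

Lemma multiplier_tens_bilinear : bilinear_for *:%R *:%R multiplier_tens.
Proof.
by apply: bilinearI => [n k m m' | m k n n']; apply: multiplier_ext;
  elim/tensor_elim => [b c | x y xE yE]; rewrite /= ?tensor_mapE /=
    ?tensPl ?tensPr // !tensor_mapD xE yE scalerDr addrACA.
Qed.
HB.instance Definition _ :=
  bilinear_isBilinear.Build K (multiplier B) (multiplier C)
    (multiplier (B ⊗ C)) *:%R *:%R multiplier_tens multiplier_tens_bilinear.
End MultiplierTensor.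

Section MultiplierTransport.
Variables (K : fieldType) (B C : nuAlgType K).
Variables (f : {linear B -> C}) (g : {linear C -> B}).
Hypotheses (fM : {morph f : x y / x ** y}) (fK : cancel f g) (gK : cancel g f).

(* Transport of multipliers along an isomorphism f of algebras. *)
Program Definition multiplier_transport (m : multiplier B) : multiplier C :=
  @Multiplier K C (f \o (mult_l m \o g) : {linear C -> C})
    (f \o (mult_r m \o g) : {linear C -> C}) _ _ _.
Next Obligation.
by move=> m x y /=; rewrite -{1}(gK x) -{1}(gK y) -fM fK mult_lM fM gK.
Qed.
Next Obligation.
by move=> m x y /=; rewrite -{1}(gK x) -{1}(gK y) -fM fK mult_rM fM gK.
Qed.
Next Obligation.
by move=> m x y /=; rewrite -{1}(gK x) -{2}(gK y) -!fM mult_lr.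
Qed.
End MultiplierTransport.

Section TensorAssoc.
Variables (K : fieldType) (A B C : nuAlgType K).

Definition tensor_assoc_core1 (a : A) (b : B) (c : C) : A ⊗ B ⊗ C :=
  a \ox b \ox c.
Lemma tensor_assoc_core1_bilinear a :
  bilinear_for *:%R *:%R (tensor_assoc_core1 a).
Proof.
apply: bilinearI => [c k b b' | b k c c']; rewrite /tensor_assoc_core1.
  by rewrite tensPr tensPl.
by rewrite tensPr.
Qed.
HB.instance Definition _ a := bilinear_isBilinear.Build K B C (A ⊗ B ⊗ C)
  *:%R *:%R (tensor_assoc_core1 a) (tensor_assoc_core1_bilinear a).

Definition tensor_assoc_core (a : A) (x : B ⊗ C) : A ⊗ B ⊗ C :=
  tensor_lift (tensor_assoc_core1 a) x.
Lemma tensor_assoc_core_bilinear : bilinear_for *:%R *:%R tensor_assoc_core.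
Proof.
apply: bilinearI => [x k a a' | a k x x']; last exact: linearP.
rewrite /tensor_assoc_core; elim/tensor_elim: x => [b c | x y xE yE].
  by rewrite !tensor_liftE /= /tensor_assoc_core1 !tensPl.
by rewrite !tensor_liftD xE yE scalerDr addrACA.
Qed.
HB.instance Definition _ := bilinear_isBilinear.Build K A (B ⊗ C) (A ⊗ B ⊗ C)
  *:%R *:%R tensor_assoc_core tensor_assoc_core_bilinear.

Definition tensor_assoc : {linear A ⊗ (B ⊗ C) -> A ⊗ B ⊗ C} :=
  tensor_lift tensor_assoc_core.

Definition tensor_assocV_core1 (c : C) (a : A) (b : B) : A ⊗ (B ⊗ C) :=
  a \ox (b \ox c).
Lemma tensor_assocV_core1_bilinear c :
  bilinear_for *:%R *:%R (tensor_assocV_core1 c).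
Proof.
apply: bilinearI => [b k a a' | a k b b']; rewrite /tensor_assocV_core1.
  by rewrite tensPl.
by rewrite tensPl tensPr.
Qed.
HB.instance Definition _ c := bilinear_isBilinear.Build K A B (A ⊗ (B ⊗ C))
  *:%R *:%R (tensor_assocV_core1 c) (tensor_assocV_core1_bilinear c).

Definition tensor_assocV_core (x : A ⊗ B) (c : C) : A ⊗ (B ⊗ C) :=
  tensor_lift (tensor_assocV_core1 c) x.
Lemma tensor_assocV_core_bilinear : bilinear_for *:%R *:%R tensor_assocV_core.
Proof.
apply: bilinearI => [c k x x' | x k c c']; first exact: linearP.
rewrite /tensor_assocV_core; elim/tensor_elim: x => [a b | x y xE yE].
  by rewrite !tensor_liftE /= /tensor_assocV_core1 !tensPr.
by rewrite !tensor_liftD xE yE scalerDr addrACA.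
Qed.
HB.instance Definition _ := bilinear_isBilinear.Build K (A ⊗ B) C (A ⊗ (B ⊗ C))
  *:%R *:%R tensor_assocV_core tensor_assocV_core_bilinear.

Definition tensor_assocV : {linear A ⊗ B ⊗ C -> A ⊗ (B ⊗ C)} :=
  tensor_lift tensor_assocV_core.

Lemma tensor_assocE a b c : tensor_assoc (a \ox (b \ox c)) = a \ox b \ox c.
Proof.
by apply: etrans (tensor_liftE _ _ _) _; apply: tensor_liftE.
Qed.
Lemma tensor_assocVE a b c : tensor_assocV (a \ox b \ox c) = a \ox (b \ox c).
Proof.
by apply: etrans (tensor_liftE _ _ _) _; apply: tensor_liftE.
Qed.

Lemma tensor_elimA (P : A ⊗ (B ⊗ C) -> Prop) :
  (forall a b c, P (a \ox (b \ox c))) ->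
  (forall x y, P x -> P y -> P (x + y)) -> forall x, P x.
Proof.
move=> Pt PD; elim/tensor_elim => [a x |]; last exact: PD.
elim/tensor_elim: x => [b c | x y Px Py]; first exact: Pt.
by have := PD _ _ Px Py; rewrite -[X in X + _]scale1r -tensPr scale1r.
Qed.

Lemma tensor_elimAV (P : A ⊗ B ⊗ C -> Prop) :
  (forall a b c, P (a \ox b \ox c)) ->
  (forall x y, P x -> P y -> P (x + y)) -> forall x, P x.
Proof.
move=> Pt PD; elim/tensor_elim => [x c |]; last exact: PD.
elim/tensor_elim: x => [a b | x y Px Py]; first exact: Pt.
by have := PD _ _ Px Py; rewrite -[X in X + _]scale1r -tensPl scale1r.
Qed.

Lemma tensor_assocK : cancel tensor_assoc tensor_assocV.
Proof.
elim/tensor_elimA => [a b c | x y xE yE].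
  by rewrite tensor_assocE tensor_assocVE.
by rewrite 2!linearD; congr (_ + _).
Qed.
Lemma tensor_assocVK : cancel tensor_assocV tensor_assoc.
Proof.
elim/tensor_elimAV => [a b c | x y xE yE].
  by rewrite tensor_assocVE tensor_assocE.
by rewrite 2!linearD; congr (_ + _).
Qed.
Lemma tensor_assocM : {morph tensor_assoc : x y / x ** y}.
Proof.
move=> x y; elim/tensor_elimA: x => [a b c | x x' xE x'E].
  elim/tensor_elimA: y => [a' b' c' | y y' yE y'E].
    by rewrite !tens_mul !tensor_assocE !tens_mul.
  by rewrite numulDr linearD yE y'E [tensor_assoc (y + y')]linearD numulDr.
by rewrite numulDl linearD xE x'E [tensor_assoc (x + x')]linearD numulDl.
Qed.

(* The identification of M(A ⊗ (B ⊗ C)) with M((A ⊗ B) ⊗ C). *)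
Definition multiplier_assoc :
    multiplier (A ⊗ (B ⊗ C)) -> multiplier (A ⊗ B ⊗ C) :=
  multiplier_transport tensor_assocM tensor_assocK tensor_assocVK.

End TensorAssoc.

Section LeftMultiplierHopf.
Variables (K : fieldType) (A : nuAlgType K).
Implicit Types (a b c : A) (eps : {scalar A}).

Local Notation "m ⊠ n" := (multiplier_tens m n) (at level 40, left associativity).
Local Notation one := (multiplier_one A).
Local Notation "\M a" := (to_multiplier a) (at level 8, a at level 8).

(* The multiplication a ⊗ b |-> a b. *)
Definition tensor_product_map : {linear A ⊗ A -> A} := tensor_lift (@numul K A).

Section Slices.
Variable eps : {scalar A}.

Definition id_eps_core (p q : A) : A := eps q *: p.
Lemma id_eps_core_bilinear : bilinear_for *:%R *:%R id_eps_core.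
Proof.
apply: bilinearI => [q k p p' | p k q q']; rewrite /id_eps_core.
  by rewrite scalerDr !scalerA mulrC.
by rewrite linearP scalerDl scalerA.
Qed.
HB.instance Definition _ := bilinear_isBilinear.Build K A A A *:%R *:%R
  id_eps_core id_eps_core_bilinear.

Definition eps_id_core (p q : A) : A := eps p *: q.
Lemma eps_id_core_bilinear : bilinear_for *:%R *:%R eps_id_core.
Proof.
apply: bilinearI => [q k p p' | p k q q']; rewrite /eps_id_core.
  by rewrite linearP scalerDl scalerA.
by rewrite scalerDr !scalerA mulrC.
Qed.
HB.instance Definition _ := bilinear_isBilinear.Build K A A A *:%R *:%R
  eps_id_core eps_id_core_bilinear.

(* The slice maps ι ⊗ ε and ε ⊗ ι from A ⊗ A to A. *)
Definition id_eps : {linear A ⊗ A -> A} := tensor_lift id_eps_core.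
Definition eps_id : {linear A ⊗ A -> A} := tensor_lift eps_id_core.
End Slices.

Variable Delta : {linear A -> multiplier (A ⊗ A)}.

Definition T1_core a b : multiplier (A ⊗ A) := Delta a ** (one ⊠ \M b).
Lemma T1_core_bilinear : bilinear_for *:%R *:%R T1_core.
Proof.
apply: bilinearI => [b k a a' | a k b b']; rewrite /T1_core linearP.
  exact: numulPl.
by rewrite (multiplier_tens_bilinear A A).2 numulPr.
Qed.
HB.instance Definition _ := bilinear_isBilinear.Build K A A
  (multiplier (A ⊗ A)) *:%R *:%R T1_core T1_core_bilinear.

Definition T4_core c a : multiplier (A ⊗ A) := Delta a ** (\M c ⊠ one).
Lemma T4_core_bilinear : bilinear_for *:%R *:%R T4_core.
Proof.
apply: bilinearI => [a k c c' | c k a a']; rewrite /T4_core linearP.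
  by rewrite (multiplier_tens_bilinear A A).1 numulPr.
exact: numulPl.
Qed.
HB.instance Definition _ := bilinear_isBilinear.Build K A A
  (multiplier (A ⊗ A)) *:%R *:%R T4_core T4_core_bilinear.

(* a ⊗ b |-> Δ(a)(1 ⊗ b) and c ⊗ a |-> Δ(a)(c ⊗ 1), as maps to M(A ⊗ A). *)
Definition T1_multiplier : {linear A ⊗ A -> multiplier (A ⊗ A)} :=
  tensor_lift T1_core.
Definition T4_multiplier : {linear A ⊗ A -> multiplier (A ⊗ A)} :=
  tensor_lift T4_core.

(* The same maps, read in A ⊗ A: T1 x is the preimage of T1_multiplier x under
   the embedding of A ⊗ A in M(A ⊗ A).  They are meaningful under the range
   conditions of left_multiplier_hopf. *)
Definition T1 (x : A ⊗ A) : A ⊗ A :=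
  'pinv_(fun=> 0) setT (@to_multiplier K (A ⊗ A)) (T1_multiplier x).
Definition T4 (x : A ⊗ A) : A ⊗ A :=
  'pinv_(fun=> 0) setT (@to_multiplier K (A ⊗ A)) (T4_multiplier x).

Definition T1_inv : A ⊗ A -> A ⊗ A := 'pinv_(fun=> 0) setT T1.

Definition Delta_id_core (p q : A) : multiplier (A ⊗ A ⊗ A) := Delta p ⊠ \M q.
Lemma Delta_id_core_bilinear : bilinear_for *:%R *:%R Delta_id_core.
Proof.
apply: bilinearI => [q k p p' | p k q q']; rewrite /Delta_id_core linearP.
  exact: (multiplier_tens_bilinear _ _).1.
exact: (multiplier_tens_bilinear _ _).2.
Qed.
HB.instance Definition _ := bilinear_isBilinear.Build K A A
  (multiplier (A ⊗ A ⊗ A)) *:%R *:%R Delta_id_core Delta_id_core_bilinear.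

Definition id_Delta_core (p q : A) : multiplier (A ⊗ (A ⊗ A)) := \M p ⊠ Delta q.
Lemma id_Delta_core_bilinear : bilinear_for *:%R *:%R id_Delta_core.
Proof.
apply: bilinearI => [q k p p' | p k q q']; rewrite /id_Delta_core linearP.
  exact: (multiplier_tens_bilinear _ _).1.
exact: (multiplier_tens_bilinear _ _).2.
Qed.
HB.instance Definition _ := bilinear_isBilinear.Build K A A
  (multiplier (A ⊗ (A ⊗ A))) *:%R *:%R id_Delta_core id_Delta_core_bilinear.

(* Δ ⊗ ι and ι ⊗ Δ, both with values in M((A ⊗ A) ⊗ A). *)
Definition Delta_id (x : A ⊗ A) : multiplier (A ⊗ A ⊗ A) :=
  tensor_lift Delta_id_core x.
Definition id_Delta (x : A ⊗ A) : multiplier (A ⊗ A ⊗ A) :=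
  multiplier_assoc (tensor_lift id_Delta_core x).

Record left_multiplier_hopf : Prop := {
  lmh_nondegenerate : nondegenerate_alg A;
  lmh_comulM : {morph Delta : a b / a ** b};
  lmh_T1_range :
    forall x, exists y : A ⊗ A, to_multiplier y = T1_multiplier x;
  lmh_T4_range :
    forall x, exists y : A ⊗ A, to_multiplier y = T4_multiplier x;
  lmh_coassoc : forall a b c,
    Delta_id (T1 (a \ox b)) ** (\M c ⊠ one ⊠ one) =
    id_Delta (T4 (c \ox a)) ** (one ⊠ one ⊠ \M b);
  lmh_T1_bij : bijective T1;
  lmh_T4_bij : bijective T4
}.

Definition is_counit eps : Prop :=
  forall a b, eps a *: b = tensor_product_map (T1_inv (a \ox b)).

End LeftMultiplierHopf.

(* Main.v *)
(** The identity [(eps ⊗ ι)(T1 (a ⊗ b)) = ab] is immediate: [eps ⊗ ι] agrees with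
    [m \o T1^-1] on [A ⊗ A].  For the other one, coassociativity says that
    [T4 ⊗ ι] and [ι ⊗ T1] commute on [A ⊗ A ⊗ A].  With [a ⊗ b = T1 x], we get
    [T4 (c ⊗ a) ⊗ b = (ι ⊗ T1)(T4 ⊗ ι)(c ⊗ x)]; applying [ι ⊗ eps ⊗ ι], whose
    composite with [ι ⊗ T1] is [ι ⊗ m], the right-hand side becomes
    [(T1 x)(c ⊗ 1) = ac ⊗ b].  The factor [b] is removed by [eps]: if [eps = 0]
    then the product of [A], hence [A], is zero.

    Coassociativity is an equality of multipliers; it passes to elements because
    the tensor product of non-degenerate algebras is non-degenerate, which
    follows from the separation of points by linear forms (Zorn). *)
Require Import Defs.
From mathcomp Require Import all_boot all_algebra.
From mathcomp Require Import reals complex.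
From mathcomp Require Import boolp classical_sets functions sesquilinear.
From HB Require Import structures.

Import GRing.Theory.
Local Open Scope ring_scope.

Section LinearForms.
Context {K : fieldType}.
Local Open Scope classical_set_scope.

(* The empty set is allowed in [P]: it is the union of the empty chain. *)
Lemma maximal_subspace_avoiding {V : lmodType K} {v : V} : v != 0 ->
  exists W : set V, [/\ W 0, forall k x y, W x -> W y -> W (k *: x + y),
    ~ W v & forall w, exists k, W (w - k *: v)].
Proof.
move=> v0.
pose P (X : set V) :=
  (forall k x y, X x -> X y -> X (k *: x + y)) /\ ~ X v.
have [F FP totF|W [[Wlin Wv] Wmax]] := @Zorn_bigcup V P.
  split=> [k x y [X FX Xx] [Y FY Yy]|[X FX Xv]]; last exact: (FP _ FX).2.
  have [XY|YX] := totF _ _ FX FY.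
    by exists Y => //; apply: (FP _ FY).1 => //; apply: XY.
  by exists X => //; apply: (FP _ FX).1 => //; apply: YX.
have W0 : W 0.
  apply: contrapT => nW0; apply: (Wmax [set 0]).
    split=> [w Ww|/(_ 0 erefl)//].
    by case: nW0; have := Wlin (-1) w w Ww Ww; rewrite scaleN1r addNr.
  split=> [k x y -> ->|/= v0']; first by rewrite scaler0 addr0.
  by rewrite v0' eqxx in v0.
exists W; split=> // w.
have [Ww|nWw] := pselect (W w); first by exists 0; rewrite scale0r subr0.
pose W' : set V := [set x | exists l u, W u /\ x = u + l *: w].
have [[l [u [Wu vE]]]|nW'v] := pselect (W' v).
  have l0 : l != 0.
    by apply/eqP => l0; apply: Wv; rewrite vE l0 scale0r addr0.
  exists l^-1.
  rewrite vE scalerDr scalerA mulVf // scale1r opprD addrCA subrr addr0.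
  by rewrite -scaleNr -[_ *: u]addr0; apply: Wlin.
exfalso; apply: (Wmax W').
  split; last first.
    move=> /(_ w) W'W; apply/nWw/W'W.
    by exists 1, 0; rewrite scale1r add0r.
  by move=> x Wx; exists 0, x; rewrite scale0r addr0.
split=> // k _ _ [l [u [Wu ->]]] [l' [u' [Wu' ->]]].
exists (k * l + l'), (k *: u + u'); split; first exact: Wlin.
by rewrite scalerDr scalerA scalerDl addrACA.
Qed.

Lemma linear_form_separates {V : lmodType K} {v : V} :
  v != 0 -> exists f : {scalar V}, f v = 1.
Proof.
move=> /maximal_subspace_avoiding[W [W0 Wlin Wv Wex]].
have WB x y : W x -> W y -> W (x - y).
  by move=> Wx Wy; rewrite addrC -scaleN1r; apply: Wlin.
have WZ k x : W x -> W (k *: x).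
  by move=> Wx; rewrite -[_ *: x]addr0; apply: Wlin.
have Wuniq w k l : W (w - k *: v) -> W (w - l *: v) -> k = l.
  move=> Wk Wl; apply/eqP/negP => /negP; rewrite -subr_eq0 => kl.
  apply: Wv; rewrite -[v](scalerK kl); apply: (WZ).
  have -> : (k - l) *: v = (w - l *: v) - (w - k *: v).
    by rewrite scalerBl opprB [RHS]addrC addrA subrK.
  exact: WB.
pose f w := projT1 (cid (Wex w)).
have fP w : W (w - f w *: v) by rewrite /f; case: cid.
have f_lin : scalar f.
  move=> k x y; apply: Wuniq (fP _) _.
  have -> : k *: x + y - (k * f x + f y) *: v
      = k *: (x - f x *: v) + (y - f y *: v).
    by rewrite scalerBr scalerDl scalerA opprD addrACA.
  exact: Wlin.
pose fM := GRing.isLinear.Build K V K *%R f f_lin.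
pose F : {scalar V} := HB.pack f fM.
exists F; apply: Wuniq (fP _) _.
by rewrite scale1r subrr.
Qed.

Lemma linear_form_eq0 {V : lmodType K} (v : V) :
  (forall f : {scalar V}, f v = 0) -> v = 0.
Proof.
move=> fv0; apply/eqP/negP => /negP /linear_form_separates[f].
by rewrite fv0 => /esym/eqP; rewrite oner_eq0.
Qed.

End LinearForms.

Section Slice.
Context {K : fieldType} {U V : lmodType K}.

Definition lslice_core (f : {scalar U}) (u : U) (v : V) : V := f u *: v.
Lemma lslice_core_bilinear f : bilinear_for *:%R *:%R (lslice_core f).
Proof.
apply: bilinearI => [v k u u'|u k v v']; rewrite /lslice_core.
  by rewrite linearP scalerDl scalerA.
by rewrite scalerDr !scalerA mulrC.
Qed.
HB.instance Definition _ f := bilinear_isBilinear.Build K U V V *:%R *:%R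
  (lslice_core f) (lslice_core_bilinear f).
Definition lslice f : {linear U ⊗ V -> V} := tensor_lift (lslice_core f).

Definition rslice_core (f : {scalar V}) (u : U) (v : V) : U := f v *: u.
Lemma rslice_core_bilinear f : bilinear_for *:%R *:%R (rslice_core f).
Proof.
apply: bilinearI => [v k u u'|u k v v']; rewrite /rslice_core.
  by rewrite scalerDr !scalerA mulrC.
by rewrite linearP scalerDl scalerA.
Qed.
HB.instance Definition _ f := bilinear_isBilinear.Build K U V U *:%R *:%R
  (rslice_core f) (rslice_core_bilinear f).
Definition rslice f : {linear U ⊗ V -> U} := tensor_lift (rslice_core f).

Lemma lsliceE f u v : lslice f (u \ox v) = f u *: v.
Proof. exact: tensor_liftE. Qed.
Lemma rsliceE f u v : rslice f (u \ox v) = f v *: u.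
Proof. exact: tensor_liftE. Qed.

Lemma tensor_sum_tens (x : U ⊗ V) :
  exists s : seq (U * V), x = \sum_(p <- s) p.1 \ox p.2.
Proof.
elim/tensor_elim: x => [u v|x y [s ->] [t ->]].
  by exists [:: (u, v)]; rewrite big_seq1.
by exists (s ++ t); rewrite big_cat.
Qed.

(* Induction on the number of terms: a relation [v0 = - \sum f u_i *: v_i] with
   [f u0 = 1], obtained by slicing, absorbs the first term in the others. *)
Lemma lslice_eq0 (x : U ⊗ V) : (forall f, lslice f x = 0) -> x = 0.
Proof.
have [s] := tensor_sum_tens x.
have [n] := ubnP (size s); elim: n s x => // n IHn [|[u v] s] x sn xE x0.
  by rewrite xE big_nil.
rewrite big_cons /= in xE.
have [u0|u0] := eqVneq u 0.
  by apply: (IHn s x) => //; rewrite xE u0 linear0l add0r.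
have [f fu1] := linear_form_separates u0.
have := congr1 (lslice f) xE; rewrite x0 linearD lsliceE fu1 scale1r linear_sum.
move=> /esym/eqP; rewrite addr_eq0 => /eqP vE.
pose s' : seq (U * V) := [seq (p.1 - f p.1 *: u, p.2) | p <- s].
apply: (IHn s' x) => //; first by rewrite size_map.
rewrite xE big_map /= vE linearNr linear_sumr -sumrN -big_split.
apply: eq_bigr => p _ /=; rewrite lsliceE linearBl linearZl_LR linearZr_LR.
by rewrite addrC.
Qed.

Lemma rslice_eq0 (x : U ⊗ V) : (forall f, rslice f x = 0) -> x = 0.
Proof.
move=> x0; apply: lslice_eq0 => f; apply: linear_form_eq0 => g.
have -> : g (lslice f x) = f (rslice g x); last by rewrite x0 linear0.
elim/tensor_elim: x {x0} => [u v|x y xE yE].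
  by rewrite lsliceE rsliceE !linearZ /= mulrC.
by rewrite !linearD /= xE yE.
Qed.

End Slice.

Section TensorMapInjective.
Context {K : fieldType} {U V U' V' : lmodType K} {I : Type}.

Lemma tensor_mapl_eq0 (F : I -> {linear U -> U'}) :
  (forall u, (forall i, F i u = 0) -> u = 0) ->
  forall x : U ⊗ V, (forall i, tensor_map (F i) idfun x = 0) -> x = 0.
Proof.
move=> Finj x x0; apply: rslice_eq0 => f; apply: Finj => i.
have -> : F i (rslice f x) = rslice f (tensor_map (F i) idfun x).
  elim/tensor_elim: x {x0} => [u v|x y xE yE].
    by rewrite tensor_mapE !rsliceE linearZ.
  by rewrite !linearD /= xE yE.
by rewrite x0 linear0.
Qed.

Lemma tensor_mapr_eq0 (F : I -> {linear V -> V'}) :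
  (forall v, (forall i, F i v = 0) -> v = 0) ->
  forall x : U ⊗ V, (forall i, tensor_map idfun (F i) x = 0) -> x = 0.
Proof.
move=> Finj x x0; apply: lslice_eq0 => f; apply: Finj => i.
have -> : F i (lslice f x) = lslice f (tensor_map idfun (F i) x).
  elim/tensor_elim: x {x0} => [u v|x y xE yE].
    by rewrite tensor_mapE !lsliceE linearZ.
  by rewrite !linearD /= xE yE.
by rewrite x0 linear0.
Qed.

End TensorMapInjective.

Section TensorNondegenerate.
Context {K : fieldType}.

Lemma tensor_nondegenerate_r {A B : nuAlgType K} :
  (forall a : A, (forall b, a ** b = 0) -> a = 0) ->
  (forall a : B, (forall b, a ** b = 0) -> a = 0) ->
  forall x : A ⊗ B, (forall y, x ** y = 0) -> x = 0.
Proof.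
move=> Anondeg Bnondeg x x0.
apply: (tensor_mapl_eq0 (fun a : A => numul_r a)) => // a.
apply: (tensor_mapr_eq0 (fun b : B => numul_r b)) => // b.
rewrite -(x0 (a \ox b)); elim/tensor_elim: x {x0} => [p q|x y xE yE].
  by rewrite !tensor_mapE tens_mul.
by rewrite !tensor_mapD numulDl xE yE.
Qed.

Lemma to_multiplier_inj {B : nuAlgType K} :
  (forall a : B, (forall b, a ** b = 0) -> a = 0) ->
  injective (@to_multiplier K B).
Proof.
move=> Bnondeg x y xy; apply/eqP; rewrite -subr_eq0; apply/eqP.
apply: Bnondeg => z.
by rewrite numulDl -[- y]scaleN1r numulZl -[x ** z]/(mult_l (to_multiplier x) z)
  xy scaleN1r subrr.
Qed.

End TensorNondegenerate.

Section MultiplierTensTheory.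
Context {K : fieldType}.
Local Notation "m ⊠ n" := (multiplier_tens m n)
  (at level 40, left associativity).

Lemma mult_l_mul {B : nuAlgType K} (m n : multiplier B) x :
  mult_l (m ** n) x = mult_l m (mult_l n x).
Proof. by []. Qed.

Lemma mult_r_mul {B : nuAlgType K} (m n : multiplier B) x :
  mult_r (m ** n) x = mult_r n (mult_r m x).
Proof. by []. Qed.

Lemma mult_l_add {B : nuAlgType K} (m n : multiplier B) x :
  mult_l (m + n) x = mult_l m x + mult_l n x.
Proof. by []. Qed.

Lemma mult_r_add {B : nuAlgType K} (m n : multiplier B) x :
  mult_r (m + n) x = mult_r m x + mult_r n x.
Proof. by []. Qed.

Lemma mult_l_to {B : nuAlgType K} (b x : B) :
  mult_l (to_multiplier b) x = b ** x.
Proof. by []. Qed.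

Lemma mult_r_to {B : nuAlgType K} (b x : B) :
  mult_r (to_multiplier b) x = x ** b.
Proof. by []. Qed.

Lemma multiplier_mulm1 {B : nuAlgType K} (m : multiplier B) :
  m ** multiplier_one B = m.
Proof. exact: multiplier_ext. Qed.

Lemma multiplier_mul1m {B : nuAlgType K} (m : multiplier B) :
  multiplier_one B ** m = m.
Proof. exact: multiplier_ext. Qed.

Lemma to_multiplierM {B : nuAlgType K} :
  {morph @to_multiplier K B : x y / x ** y}.
Proof.
by move=> x y; apply: multiplier_ext => z /=; rewrite /numul_r numulA.
Qed.

Lemma mult_l_tens {B C : nuAlgType K} (m : multiplier B) (n : multiplier C) b c :
  mult_l (m ⊠ n) (b \ox c) = mult_l m b \ox mult_l n c.
Proof. exact: tensor_mapE. Qed.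

Lemma mult_r_tens {B C : nuAlgType K} (m : multiplier B) (n : multiplier C) b c :
  mult_r (m ⊠ n) (b \ox c) = mult_r m b \ox mult_r n c.
Proof. exact: tensor_mapE. Qed.

Lemma to_multiplierP {B : nuAlgType K} k (x y : B) :
  to_multiplier (k *: x + y) = k *: to_multiplier x + to_multiplier y.
Proof. exact: linearP. Qed.

Lemma to_multiplierD {B : nuAlgType K} :
  {morph @to_multiplier K B : x y / x + y}.
Proof. exact: linearD. Qed.

Lemma multiplier_tensM {B C : nuAlgType K} (m m' : multiplier B)
    (n n' : multiplier C) :
  (m ⊠ n) ** (m' ⊠ n') = (m ** m') ⊠ (n ** n').
Proof.
by apply: multiplier_ext; elim/tensor_elim => [b c|x y xE yE];
  [rewrite /= !tensor_mapE | rewrite !linearD xE yE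
  |rewrite /= !tensor_mapE | rewrite !linearD xE yE].
Qed.

Lemma to_multiplier_tens {B C : nuAlgType K} (b : B) (c : C) :
  to_multiplier (b \ox c) = to_multiplier b ⊠ to_multiplier c.
Proof.
by apply: multiplier_ext; elim/tensor_elim => [p q|x y xE yE];
  [rewrite /= tensor_mapE tens_mul | rewrite !linearD xE yE
  |rewrite /= tensor_mapE /numul_r tens_mul | rewrite !linearD xE yE].
Qed.

Lemma to_multiplier_mulr1 {B C : nuAlgType K} (c : C) (x : B ⊗ C) :
  to_multiplier (tensor_map idfun (numul_r c) x) =
  to_multiplier x ** (multiplier_one B ⊠ to_multiplier c).
Proof.
elim/tensor_elim: x => [p q|x y xE yE]; last first.
  by rewrite tensor_mapD !to_multiplierD xE yE numulDl.
rewrite tensor_mapE !to_multiplier_tens multiplier_tensM multiplier_mulm1.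
by rewrite /numul_r to_multiplierM.
Qed.

Lemma to_multiplier_mulr2 {B C : nuAlgType K} (b : B) (x : B ⊗ C) :
  to_multiplier (tensor_map (numul_r b) idfun x) =
  to_multiplier x ** (to_multiplier b ⊠ multiplier_one C).
Proof.
elim/tensor_elim: x => [p q|x y xE yE]; last first.
  by rewrite tensor_mapD !to_multiplierD xE yE numulDl.
rewrite tensor_mapE !to_multiplier_tens multiplier_tensM multiplier_mulm1.
by rewrite /numul_r to_multiplierM.
Qed.

Section Assoc.
Context {A B C : nuAlgType K}.

Lemma mult_l_assoc (m : multiplier (A ⊗ (B ⊗ C))) x :
  mult_l (multiplier_assoc m) x =
  tensor_assoc A B C (mult_l m (tensor_assocV A B C x)).
Proof. by []. Qed.

Lemma mult_r_assoc (m : multiplier (A ⊗ (B ⊗ C))) x :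
  mult_r (multiplier_assoc m) x =
  tensor_assoc A B C (mult_r m (tensor_assocV A B C x)).
Proof. by []. Qed.

Lemma multiplier_assoc_tens (m : multiplier A) (n : multiplier B)
    (p : multiplier C) :
  multiplier_assoc (m ⊠ (n ⊠ p)) = m ⊠ n ⊠ p.
Proof.
apply: multiplier_ext; elim/tensor_elimAV => [a b c|x y xE yE].
- by rewrite mult_l_assoc tensor_assocVE !mult_l_tens tensor_assocE.
- by rewrite !linearD xE yE.
- by rewrite mult_r_assoc tensor_assocVE !mult_r_tens tensor_assocE.
- by rewrite !linearD xE yE.
Qed.

Lemma multiplier_assocM : {morph @multiplier_assoc K A B C : m n / m ** n}.
Proof.
move=> m n; apply: multiplier_ext => x.
- rewrite (mult_l_assoc (m ** n)) (mult_l_mul m n).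
  rewrite (mult_l_mul (multiplier_assoc m)) (mult_l_assoc m).
  by rewrite (mult_l_assoc n) (tensor_assocK (mult_l n _)).
- rewrite (mult_r_assoc (m ** n)) (mult_r_mul m n).
  rewrite (mult_r_mul (multiplier_assoc m)) (mult_r_assoc n).
  by rewrite (mult_r_assoc m) (tensor_assocK (mult_r m _)).
Qed.

Lemma multiplier_assocD : {morph @multiplier_assoc K A B C : m n / m + n}.
Proof.
move=> m n; apply: multiplier_ext => x.
- rewrite (mult_l_assoc (m + n)) (mult_l_add m n) linearD.
  rewrite (mult_l_add (multiplier_assoc m)).
  by rewrite (mult_l_assoc m) (mult_l_assoc n).
- rewrite (mult_r_assoc (m + n)) (mult_r_add m n) linearD.
  rewrite (mult_r_add (multiplier_assoc m)).
  by rewrite (mult_r_assoc m) (mult_r_assoc n).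
Qed.

Lemma multiplier_assoc_to (x : A ⊗ (B ⊗ C)) :
  multiplier_assoc (to_multiplier x) = to_multiplier (tensor_assoc A B C x).
Proof.
apply: multiplier_ext => z.
  rewrite mult_l_assoc (mult_l_to x) (tensor_assocM x) (tensor_assocVK z).
  by rewrite mult_l_to.
rewrite mult_r_assoc (mult_r_to x) (tensor_assocM _ x) (tensor_assocVK z).
by rewrite mult_r_to.
Qed.

End Assoc.
End MultiplierTensTheory.

Section CounitIdentities.
Context {K : fieldType} {A : nuAlgType K}.
Context {Delta : {linear A -> multiplier (A ⊗ A)}}.
Context (HA : left_multiplier_hopf Delta).
Local Notation "m ⊠ n" := (multiplier_tens m n)
  (at level 40, left associativity).
Local Notation one := (multiplier_one A).
Local Notation "\M a" := (to_multiplier a) (at level 8, a at level 8).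

Let nondegA : forall a : A, (forall b, a ** b = 0) -> a = 0 :=
  (lmh_nondegenerate HA).1.

Lemma to_multiplier_inj2 : injective (@to_multiplier K (A ⊗ A)).
Proof. exact/to_multiplier_inj/tensor_nondegenerate_r. Qed.

Lemma to_multiplier_inj3 : injective (@to_multiplier K (A ⊗ A ⊗ A)).
Proof.
apply/to_multiplier_inj/tensor_nondegenerate_r => //.
exact: tensor_nondegenerate_r.
Qed.

Lemma to_multiplier_T1 x : \M (T1 Delta x) = T1_multiplier Delta x.
Proof.
have [y yx] := lmh_T1_range HA x.
by rewrite /T1 pinvK // -yx; apply/mem_set; exists y.
Qed.

Lemma to_multiplier_T4 x : \M (T4 Delta x) = T4_multiplier Delta x.
Proof.
have [y yx] := lmh_T4_range HA x.
by rewrite /T4 pinvK // -yx; apply/mem_set; exists y.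
Qed.

Lemma T1_is_linear : linear (T1 Delta).
Proof.
move=> k x y; apply: to_multiplier_inj2.
by rewrite to_multiplierP !to_multiplier_T1 linearP.
Qed.

Lemma T4_is_linear : linear (T4 Delta).
Proof.
move=> k x y; apply: to_multiplier_inj2.
by rewrite to_multiplierP !to_multiplier_T4 linearP.
Qed.

Let T1L : {linear A ⊗ A -> A ⊗ A} :=
  HB.pack (T1 Delta) (GRing.isLinear.Build K _ _ *:%R _ T1_is_linear).
Let T4L : {linear A ⊗ A -> A ⊗ A} :=
  HB.pack (T4 Delta) (GRing.isLinear.Build K _ _ *:%R _ T4_is_linear).

Lemma to_multiplier_T1_tens a b :
  \M (T1 Delta (a \ox b)) = Delta a ** (one ⊠ \M b).
Proof. by rewrite to_multiplier_T1; apply: tensor_liftE. Qed.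

Lemma to_multiplier_T4_tens c a :
  \M (T4 Delta (c \ox a)) = Delta a ** (\M c ⊠ one).
Proof. by rewrite to_multiplier_T4; apply: tensor_liftE. Qed.

Lemma T1K : cancel (T1 Delta) (T1_inv Delta).
Proof.
move=> x; rewrite /T1_inv pinvKV ?inE //.
by have /bij_inj injT1 := lmh_T1_bij HA; apply: in2W.
Qed.

Lemma T1_invK : cancel (T1_inv Delta) (T1 Delta).
Proof.
move=> x; rewrite /T1_inv pinvK //.
by have [g _ gK] := lmh_T1_bij HA; apply/mem_set; exists (g x).
Qed.

Lemma T1_invD : {morph T1_inv Delta : x y / x + y}.
Proof.
move=> x y; apply: (can_inj T1K).
by rewrite T1_invK -[RHS]/(T1L (_ + _)) linearD /= !T1_invK.
Qed.

Lemma Delta_id_T4 c (x : A ⊗ A) :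
  Delta_id Delta x ** (\M c ⊠ one ⊠ one) =
  \M (tensor_map T4L idfun (tensor_assoc A A A (c \ox x))).
Proof.
elim/tensor_elim: x => [p q|x y xE yE].
  rewrite tensor_assocE tensor_mapE to_multiplier_tens to_multiplier_T4_tens.
  by rewrite /Delta_id tensor_liftE multiplier_tensM multiplier_mulm1.
by rewrite /Delta_id linearD numulDl xE yE linearDr !linearD.
Qed.

Lemma id_Delta_T1 b (x : A ⊗ A) :
  id_Delta Delta x ** (one ⊠ one ⊠ \M b) =
  \M (tensor_assoc A A A (tensor_map idfun T1L (tensor_assocV A A A (x \ox b)))).
Proof.
elim/tensor_elim: x => [p q|x y xE yE].
  rewrite tensor_assocVE tensor_mapE -multiplier_assoc_to to_multiplier_tens.
  rewrite to_multiplier_T1_tens /id_Delta tensor_liftE -multiplier_assoc_tens.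
  rewrite -(multiplier_assocM (\M p ⊠ Delta q)) multiplier_tensM.
  by rewrite multiplier_mulm1.
rewrite /id_Delta linearD (multiplier_assocD (tensor_lift _ x)) numulDl xE yE.
by rewrite linearDl !linearD.
Qed.

Lemma T4_T1_comm c (x : A ⊗ A) :
  tensor_map T4L idfun (tensor_assoc A A A (c \ox T1 Delta x)) =
  tensor_assoc A A A (tensor_map idfun T1L (tensor_assocV A A A
    (tensor_map T4L idfun (tensor_assoc A A A (c \ox x))))).
Proof.
elim/tensor_elim: x => [a b|x y xE yE].
  apply: to_multiplier_inj3; rewrite -Delta_id_T4 (lmh_coassoc HA) id_Delta_T1.
  by rewrite tensor_assocE tensor_mapE.
by rewrite -[T1 Delta (x + y)]/(T1L _) linearD !linearDr !linearD xE yE.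
Qed.

Lemma tensor_product_T4 c (x : A ⊗ A) :
  tensor_map idfun (tensor_product_map A) (tensor_assocV A A A
    (tensor_map T4L idfun (tensor_assoc A A A (c \ox x)))) =
  tensor_map (numul_r c) idfun (T1 Delta x).
Proof.
elim/tensor_elim: x => [p q|x y xE yE]; last first.
  by rewrite -[T1 Delta (x + y)]/(T1L _) !linearDr !linearD xE yE.
rewrite tensor_assocE tensor_mapE.
have -> (y : A ⊗ A) : tensor_map idfun (tensor_product_map A)
    (tensor_assocV A A A (y \ox q)) = tensor_map idfun (numul_r q) y.
  elim/tensor_elim: y => [u v|y z yE zE].
    by rewrite tensor_assocVE !tensor_mapE [tensor_product_map A _]tensor_liftE.
  by rewrite linearDl !linearD yE zE.
apply: to_multiplier_inj2.
rewrite to_multiplier_mulr1 to_multiplier_mulr2 to_multiplier_T4_tens.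
rewrite to_multiplier_T1_tens -!numulA !multiplier_tensM.
by rewrite !multiplier_mulm1 !multiplier_mul1m.
Qed.

Context {eps : {scalar A}} (Heps : is_counit Delta eps).

Lemma eps_id_T1 x : eps_id eps (T1 Delta x) = tensor_product_map A x.
Proof.
have epsE y : eps_id eps y = tensor_product_map A (T1_inv Delta y).
  elim/tensor_elim: y => [a b|y z yE zE].
    by rewrite -Heps; apply: tensor_liftE.
  by rewrite linearD yE zE T1_invD linearD.
by rewrite epsE T1K.
Qed.

Lemma id_eps_T4_tens (a b c : A) :
  id_eps eps (T4 Delta (c \ox a)) \ox b = (a ** c) \ox b.
Proof.
have sliceE (y : A ⊗ A) : tensor_map idfun (eps_id eps)
    (tensor_assocV A A A (y \ox b)) = id_eps eps y \ox b.
  elim/tensor_elim: y => [u v|y z yE zE].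
    rewrite tensor_assocVE tensor_mapE.
    rewrite [eps_id _ _]tensor_liftE [id_eps _ _]tensor_liftE.
    by rewrite linearZl_LR linearZr_LR.
  by rewrite linearDl !linearD yE zE linearDl.
have epsT1 (z : A ⊗ (A ⊗ A)) :
    tensor_map idfun (eps_id eps) (tensor_map idfun T1L z) =
    tensor_map idfun (tensor_product_map A) z.
  elim/tensor_elim: z => [u v|y z yE zE]; last by rewrite !linearD yE zE.
  by rewrite !tensor_mapE eps_id_T1.
rewrite -sliceE; have := T4_T1_comm c (T1_inv Delta (a \ox b)).
rewrite T1_invK tensor_assocE tensor_mapE => ->.
rewrite (tensor_assocK (tensor_map _ _ _)) epsT1.
by rewrite tensor_product_T4 T1_invK tensor_mapE.
Qed.

Lemma id_eps_T4 a c : id_eps eps (T4 Delta (c \ox a)) = a ** c.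
Proof.
have [[b epsb]|eps0] := pselect (exists b, eps b != 0).
  have := congr1 (id_eps eps) (id_eps_T4_tens a b c).
  rewrite ![id_eps eps (_ \ox b)]tensor_liftE; exact: scalerI.
have A0 (x : A) : x = 0.
  apply: nondegA => b; rewrite -[_ ** _](tensor_liftE (@numul K A)).
  rewrite -[LHS]/(tensor_product_map A (x \ox b)) -eps_id_T1.
  elim/tensor_elim: (T1 _ _) => [u v|y z yE zE].
    rewrite [LHS]tensor_liftE /= /eps_id_core.
    have [->|epsu] := eqVneq (eps u) 0; first exact: scale0r.
    by case: eps0; exists u.
  by rewrite linearD yE zE addr0.
by rewrite [LHS]A0 [RHS]A0.
Qed.

End CounitIdentities.

Theorem proposition3p8 (R : realType) (A : nuAlgType R[i])
    (Delta : {linear A -> multiplier (A ⊗ A)})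
    (HA : left_multiplier_hopf Delta)
    (eps : {scalar A}) (Heps : is_counit Delta eps) :
  (forall a c : A, id_eps eps (T4 Delta (c \ox a)) = a ** c) /\
  (forall a b : A, eps_id eps (T1 Delta (a \ox b)) = a ** b).
Proof.
split=> [a c|a b]; first exact: id_eps_T4.
rewrite eps_id_T1 //; exact: tensor_liftE.
Qed.
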